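(* Let $G$ be a finite simple graph on the vertex set $\{x_1,\dots,x_n\}$, let $K$ be a field, let $J=J(G)\subseteq K[x_1,\dots,x_n]$ be the cover ideal of $G$, and let $\mathbf{m}=x_1x_2\cdots x_n$. Then $G$ is a bipartite graph if and only if $\mathbf{m}\in J^2$.
   Context: A graph here is a finite hypergraph in which every edge is a set of exactly two vertices. A vertex cover of $G$ is a set of vertices meeting every edge; a set of vertices is identified with the squarefree monomial that is the product of its elements. The cover ideal is $J(G)=(w : w\text{ is a vertex cover of }G)$. A bipartite graph is one whose vertices can be properly colored with two colors (equivalently, a graph with no odd circuits). *)

(* Defs.v *)
From HB Require Import structures.
From mathcomp Require Import all_boot all_order all_algebra.
From mathcomp Require Import mpoly.

Set Implicit Arguments.
Unset Strict Implicit.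
Unset Printing Implicit Defensive.

Import GRing.Theory.
Local Open Scope ring_scope.

Record graph (n : nat) := Graph {
  edges : {set {set 'I_n}};
  card_edge : forall e : {set 'I_n}, e \in edges -> #|e| = 2%N
}.

Definition vertex_cover (n : nat) (G : graph n) (W : {set 'I_n}) : Prop :=
  forall e : {set 'I_n}, e \in edges G -> e :&: W != set0.

(* There is no edge [set x; x], since edges have exactly two elements. *)
Definition proper_coloring (n k : nat) (G : graph n) (c : 'I_n -> 'I_k) : Prop :=
  forall x y : 'I_n, [set x; y] \in edges G -> c x != c y.

Definition bipartite (n : nat) (G : graph n) : Prop :=
  exists c : 'I_n -> 'I_2, proper_coloring G c.

(* Ideals are Prop-valued predicates: the ideals of ring_quotient are proper
   by definition, whereas a cover ideal is the unit ideal when the graph has no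
   edges. *)
Definition ideal_gen (R : comNzRingType) (S : R -> Prop) (f : R) : Prop :=
  exists (k : nat) (a s : 'I_k -> R),
    (forall i, S (s i)) /\ f = \sum_(i < k) a i * s i.

Definition ideal_mul (R : comNzRingType) (I J : R -> Prop) : R -> Prop :=
  ideal_gen (fun h => exists f g : R, [/\ I f, J g & h = f * g]).

Definition set_monomial (K : fieldType) (n : nat) (W : {set 'I_n}) :
    {mpoly K[n]} :=
  \prod_(i in W) 'X_i.

Definition cover_ideal (K : fieldType) (n : nat) (G : graph n) :
    {mpoly K[n]} -> Prop :=
  ideal_gen (fun f => exists W : {set 'I_n},
    vertex_cover G W /\ f = set_monomial K W).

Arguments cover_ideal K {n} G f.

(* Main.v *)
Require Import Defs.
From HB Require Import structures.
From mathcomp Require Import all_boot all_order all_algebra.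
From mathcomp Require Import mpoly.

(* Each class of a proper 2-colouring is a vertex cover, and the two classes
   partition the vertices, so m is a product of two generators of J.
   Conversely, if any two vertex covers meet, every product of two generators
   of J is divisible by the square of a variable, so the squarefree monomial m
   does not occur in any element of J^2. Hence some two vertex covers are
   disjoint, and membership in one of them is a proper 2-colouring. *)

Set Implicit Arguments.
Unset Strict Implicit.
Unset Printing Implicit Defensive.

Import GRing.Theory.
Local Open Scope ring_scope.

Lemma ideal_gen_mem (R : comNzRingType) (S : R -> Prop) (f : R) :
  S f -> ideal_gen S f.
Proof.
move=> Sf; exists 1%N, (fun=> 1), (fun=> f); split=> //.
by rewrite big_ord1 mul1r.
Qed.

Lemma ideal_gen_min (R : comNzRingType) (S Q : R -> Prop) :
  Q 0 -> (forall f g, Q f -> Q g -> Q (f + g)) ->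
  (forall a f, Q f -> Q (a * f)) -> (forall f, S f -> Q f) ->
  forall f, ideal_gen S f -> Q f.
Proof.
move=> Q0 QD QM SQ _ [k [a [s [Ss ->]]]].
by apply: (big_ind Q) => // i _; apply: QM; apply: SQ.
Qed.

(** With [g] fixed, the [f] with [Q (f * g)] are closed under the ideal operations, so [f] may be
    taken to be a generator; the same argument then applies to [g]. *)
Lemma ideal_mul_gen_min (R : comNzRingType) (S T Q : R -> Prop) :
  Q 0 -> (forall f g, Q f -> Q g -> Q (f + g)) ->
  (forall a f, Q f -> Q (a * f)) -> (forall f g, S f -> T g -> Q (f * g)) ->
  forall f, ideal_mul (ideal_gen S) (ideal_gen T) f -> Q f.
Proof.
move=> Q0 QD QM STQ; apply: ideal_gen_min => // _ [f [g [If Jg ->]]].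
apply: (ideal_gen_min (Q := fun f => Q (f * g))) If => [|f1 f2|a f1|{}f Sf].
- by rewrite mul0r.
- by rewrite mulrDl; apply: QD.
- by rewrite -mulrA; apply: QM.
apply: (ideal_gen_min (Q := fun g => Q (f * g))) Jg => [|g1 g2|a g1|{}g Tg].
- by rewrite mulr0.
- by rewrite mulrDr; apply: QD.
- by rewrite mulrCA; apply: QM.
exact: STQ.
Qed.

Lemma mem_set2_pair (T : finType) (x y : T) (W : {set T}) :
  [set x; y] :&: W != set0 -> (x \in W) || (y \in W).
Proof.
by case/set0Pn=> z; rewrite !inE => /andP[/orP[]/eqP-> ->]; rewrite ?orbT.
Qed.

(** An edge has just two vertices, so it meets both [W] and [~: W] exactly when [W] contains one of
    them and not the other. *)
Lemma bipartite_coverC (n : nat) (G : graph n) :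
  bipartite G <->
  exists W : {set 'I_n}, vertex_cover G W /\ vertex_cover G (~: W).
Proof.
split=> [[c Gc]|[W [cov covC]]]; last first.
  exists (fun x => if x \in W then ord0 else ord_max) => x y Gxy.
  have := mem_set2_pair (cov _ Gxy); have := mem_set2_pair (covC _ Gxy).
  by rewrite !inE; case: (x \in W); case: (y \in W).
have split_edge e : e \in edges G ->
    exists x y, [/\ x \in e, y \in e & (c x == ord0) != (c y == ord0)].
  move=> Ge; have /eqP/cards2P[x [y [_ e_xy]]] := card_edge Ge.
  exists x, y; rewrite e_xy !inE !eqxx orbT; split=> //.
  have := Gc x y; rewrite -e_xy => /(_ Ge).
  (* With two colours, distinct colours mean that exactly one is [ord0]. *)
  by case: (c x) (c y) => [[|[|//]] ?] [[|[|//]] ?].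
exists [set x | c x == ord0]; split=> e /split_edge[x [y [ex ey cxy]]];
  apply/set0Pn; have [cx|cx] := boolP (c x == ord0).
- by exists x; rewrite !inE ex.
- by exists y; rewrite !inE ey; move: cxy; rewrite (negPf cx);
  case: (c y == ord0).
- by exists y; rewrite !inE ey; move: cxy; rewrite cx; case: (c y == ord0).
- by exists x; rewrite !inE ex cx.
Qed.

(** Every monomial of the product has exponent at least 2 at [x], so [m] is not among them. *)
Lemma mcoeff_mul_sqrX_eq0 (K : fieldType) (n : nat) (f : {mpoly K[n]})
    (m : 'X_{1..n}) (x : 'I_n) :
  (m x < 2)%N -> (f * 'X_x ^+ 2)@_m = 0.
Proof.
move=> mx; rewrite mpolyXn; apply: memN_msupp_eq0.
rewrite (perm_mem (msuppMX _ _)); apply/mapP => -[m' _ m_eq].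
by move: mx; rewrite m_eq mnmDE mulmnE mnm1E eqxx.
Qed.

Lemma set_monomial_meet (K : fieldType) (n : nat) (W1 W2 : {set 'I_n}) x :
  x \in W1 -> x \in W2 ->
  exists h, set_monomial K W1 * set_monomial K W2 = h * 'X_x ^+ 2.
Proof.
move=> x1 x2; rewrite /set_monomial (big_setD1 x x1) (big_setD1 x x2) /=.
by eexists; rewrite mulrACA mulrC expr2.
Qed.

Theorem corollary3p14 (n : nat) (G : graph n) (K : fieldType) :
  bipartite G <->
  ideal_mul (cover_ideal K G) (cover_ideal K G) (\prod_(i < n) 'X_i).
Proof.
split=> [/bipartite_coverC[W [cov covC]]|].
  have gen V : vertex_cover G V -> cover_ideal K G (set_monomial K V).
    by move=> covV; apply: ideal_gen_mem; exists V.
  apply: ideal_gen_mem; exists (set_monomial K W), (set_monomial K (~: W)).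
  split; [exact: gen | exact: gen | rewrite (bigID (mem W)) /=; congr (_ * _)].
  by apply: eq_bigl => x; rewrite inE.
pose m := [multinom 1%N | _ < n].
have -> : \prod_(i < n) 'X_i = 'X_[K, m].
  by rewrite mpolyXE_id; apply: eq_bigr => i _; rewrite mnmE expr1.
(* The disjunct [bipartite G] makes Q an ideal without first having to decide
   whether G has two disjoint vertex covers. *)
move=> J2m; pose Q f := bipartite G \/ forall a : {mpoly K[n]}, (a * f)@_m = 0.
(* The coefficient of [m] in its own monomial is 1, so [a = 1] refutes the second disjunct. *)
suff [//|/(_ 1)/eqP] : Q 'X_[K, m].
  by rewrite mul1r mcoeffX eqxx oner_eq0.
apply: (ideal_mul_gen_min (Q := Q)) J2m.
- by right=> a; rewrite mulr0 mcoeff0.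
- move=> f g [?|f0] [?|g0]; try by left.
  by right=> a; rewrite mulrDr mcoeffD f0 g0 addr0.
(* The quantifier over [a] in [Q] absorbs the multiplier [b]. *)
- move=> b f [bip|f0]; first by left.
  by right=> a; rewrite mulrA f0.
move=> _ _ [W1 [cov1 ->]] [W2 [cov2 ->]].
have [dis|/pred0Pn[x /andP[x1 x2]]] := boolP [disjoint W1 & W2].
  (* Disjointness puts [W2] inside [~: W1], which is therefore a cover too. *)
  left; apply/bipartite_coverC; exists W1; split=> // e /cov2.
  apply: contraNN; rewrite -!subset0; apply/subset_trans/setIS.
  by rewrite -disjoints_subset disjoint_sym.
have [h ->] := set_monomial_meet K x1 x2.
by right=> a; rewrite mulrA mcoeff_mul_sqrX_eq0 // mnmE.
Qed.
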